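(* (a) Given $s\ge 2$, there exists a strongly connected digraph $D$ such that $\overrightarrow{strc}(D)\ge\overrightarrow{trc}(D)\ge s$ and $\overrightarrow{rc}(D)=\overrightarrow{src}(D)=3$. (b) Given $s\ge 4$, there exists a strongly connected digraph $D$ such that $\overrightarrow{trc}(D)=\overrightarrow{strc}(D)\ge s$ and $\overrightarrow{rvc}(D)=\overrightarrow{srvc}(D)=3$.
   Context: All digraphs are finite, without loops and without multiple arcs; strongly connected means every ordered pair $(u,v)$ is joined by a directed $u$–$v$ path; a geodesic is a shortest directed path. An arc-coloured path is rainbow if its arcs have distinct colours; a vertex-coloured path is vertex-rainbow if its internal vertices have distinct colours; a total-coloured path is total-rainbow if its arcs and internal vertices all receive pairwise distinct colours. $\overrightarrow{rc}(D)$, $\overrightarrow{src}(D)$: minimum number of colours in an arc-colouring such that every ordered pair $(u,v)$ is joined by a rainbow path, resp. rainbow geodesic. $\overrightarrow{rvc}(D)$, $\overrightarrow{srvc}(D)$: minimum number of colours in a vertex-colouring such that every ordered pair is joined by a vertex-rainbow path, resp. geodesic. $\overrightarrow{trc}(D)$, $\overrightarrow{strc}(D)$: minimum number of colours in a total-colouring (of vertices and arcs) such that every ordered pair is joined by a total-rainbow path, resp. geodesic. *)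

(* Defs.v *)
From mathcomp Require Import all_boot.
From mathcomp Require Import boolp classical_sets.

Set Implicit Arguments.
Unset Strict Implicit.
Unset Printing Implicit Defensive.

Record digraph := Digraph {
  vertex :> finType;
  arc : rel vertex;
  arc_irr : irreflexive arc }.

Definition strongly_connected (D : digraph) : Prop :=
  forall u v : D, connect (@arc D) u v.

Section Paths.
Variable D : digraph.
Implicit Types (u v : D) (p : seq D).

(* A directed path from u to v is represented by u together with the sequence
   p of its remaining vertices; for u = v it is the trivial path p = [::]. *)
Definition dipath u v p : Prop :=
  [/\ path (@arc D) u p, uniq (u :: p) & last u p = v].

Definition geodesic u v p : Prop :=
  dipath u v p /\ forall q, dipath u v q -> size p <= size q.

Definition internal u p : seq D := behead (belast u p).

Definition rainbow (ca : D -> D -> nat) u p : bool := uniq (pairmap ca u p).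

Definition vertex_rainbow (cv : D -> nat) u p : bool :=
  uniq (map cv (internal u p)).

Definition total_rainbow (cv : D -> nat) (ca : D -> D -> nat) u p : bool :=
  uniq (map cv (internal u p) ++ pairmap ca u p).

Definition all_joined (route : D -> D -> seq D -> Prop) (good : D -> seq D -> bool) : Prop :=
  forall u v, exists2 p, route u v p & good u p.

(* The colours available to a k-colouring are 0, ..., k - 1. Only the values
   of an arc-colouring on pairs that are arcs are constrained or ever used. *)
Definition arc_colouring k (ca : D -> D -> nat) : Prop :=
  forall u v, arc u v -> ca u v < k.

Definition vertex_colouring k (cv : D -> nat) : Prop := forall u, cv u < k.

Definition arc_connectable route k : Prop :=
  exists2 ca, arc_colouring k ca & all_joined route (rainbow ca).

Definition vertex_connectable route k : Prop :=
  exists2 cv, vertex_colouring k cv & all_joined route (vertex_rainbow cv).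

Definition total_connectable route k : Prop :=
  exists cv ca, [/\ vertex_colouring k cv, arc_colouring k ca
                  & all_joined route (total_rainbow cv ca)].

End Paths.

(* The least element of P, with the junk value 0 if P is empty; the predicates
   it is applied to below are nonempty when D is strongly connected. *)
Definition least (P : nat -> Prop) : nat :=
  xget 0 [set k | P k /\ forall j, P j -> k <= j]%classic.

Lemma leastP (P : nat -> Prop) :
  (exists k, P k) -> P (least P) /\ forall j, P j -> least P <= j.
Proof.
move=> exP; rewrite /least; case: xgetP => [k _ //|] noleast.
have exb : exists k, `[< P k >] by case: exP => k Pk; exists k; apply/asboolP.
case: (ex_minnP exb) => m /asboolP Pm minm; case: (noleast m).
by split=> // j Pj; apply: minm; apply/asboolP.
Qed.

Definition rc (D : digraph) : nat := least (arc_connectable (@dipath D)).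
Definition src (D : digraph) : nat := least (arc_connectable (@geodesic D)).
Definition rvc (D : digraph) : nat := least (vertex_connectable (@dipath D)).
Definition srvc (D : digraph) : nat := least (vertex_connectable (@geodesic D)).
Definition trc (D : digraph) : nat := least (total_connectable (@dipath D)).
Definition strc (D : digraph) : nat := least (total_connectable (@geodesic D)).

(* Main.v *)
Require Import Defs.
From mathcomp Require Import all_boot.
From mathcomp Require Import boolp.

Set Implicit Arguments.
Unset Strict Implicit.
Unset Printing Implicit Defensive.

(** (a) Take the complete bidirected digraph on s hubs and hang a bidirected
    pendant leaf on each hub. Leaf-to-leaf distances are 3, and colouring arcs
    by their type (leaf to hub, hub to hub, hub to leaf) makes all geodesics
    rainbow. But every path between the leaves at hubs i and j has both hubs as
    internal vertices, so a total-colouring gives distinct colours to the hubs.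

    (b) Take s directed triangles c -> a_i -> b_i -> c sharing the vertex c.
    Directed paths are unique, hence geodesic. Colouring the vertices by their
    type (a, b or c) makes all paths vertex-rainbow, but the only path from a_i
    to b_j is a_i b_i c a_j b_j, so a total-colouring gives distinct colours to
    the arcs a_i b_i. *)

(** * Least elements and counting of colours *)

Lemma least_eq (P : nat -> Prop) k :
  P k -> (forall j, P j -> k <= j) -> least P = k.
Proof.
move=> Pk mink; have [Pl minl] := leastP (ex_intro P k Pk).
by apply/eqP; rewrite eqn_leq minl // mink.
Qed.

(** The existence hypothesis excludes the junk value 0 that [least] takes on an empty predicate. *)
Lemma least_ge (P : nat -> Prop) s :
  (exists k, P k) -> (forall j, P j -> s <= j) -> s <= least P.
Proof. by move=> /leastP[Pl _]; apply. Qed.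

Lemma uniq_ltn_size (s : seq nat) k :
  uniq s -> (forall x, x \in s -> x < k) -> size s <= k.
Proof.
move=> us ltk; rewrite -(size_iota 0 k); apply: uniq_leq_size => // x /ltk.
by rewrite mem_iota.
Qed.

Lemma inj_ltn_leq n k (f : 'I_n -> nat) :
  injective f -> (forall i, f i < k) -> n <= k.
Proof.
move=> injf ltk; rewrite -[leqLHS]card_ord cardE -(size_map f).
apply: uniq_ltn_size; first by rewrite map_inj_uniq ?enum_uniq.
by move=> x /mapP[i _ ->].
Qed.

(** * Paths and colourings in an arbitrary digraph *)

Section General.
Variable D : digraph.
Implicit Types (u v w : D) (p q : seq D).

Lemma dipath_connect u v p : dipath u v p -> connect (@Defs.arc D) u v.
Proof. by case=> up _ <-; apply/connectP; exists p. Qed.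

Lemma geodesic_exists u v : connect (@Defs.arc D) u v -> exists p, geodesic u v p.
Proof.
case/connectP=> p0 /shortenP[p up uniqp _] ->; set w := last u p.
have exq : exists n, `[< exists2 q, dipath u w q & size q = n >].
  by exists (size p); apply/asboolP; exists p.
case: (ex_minnP exq) => n /asboolP[q dq <-] minq.
by exists q; split=> // r dr; apply: minq; apply/asboolP; exists r.
Qed.

Lemma all_joined_sub (R1 R2 : D -> D -> seq D -> Prop) good :
  (forall u v p, R1 u v p -> R2 u v p) ->
  all_joined R1 good -> all_joined R2 good.
Proof. by move=> sub j u v; have [p /sub ? ?] := j u v; exists p. Qed.

Lemma geodesic_dipath u v p : geodesic u v p -> dipath u v p.
Proof. by case. Qed.

Lemma total_geodesic_dipath k :
  total_connectable (@geodesic D) k -> total_connectable (@dipath D) k.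
Proof.
case=> cv [ca [hv ha j]]; exists cv, ca; split=> //.
exact: all_joined_sub geodesic_dipath j.
Qed.

(** Giving every vertex and every arc its own colour makes all geodesics total-rainbow. This
    guarantees that [trc] and [strc] are genuine minima. *)
Lemma total_geodesic_connectable :
  strongly_connected D -> exists k, total_connectable (@geodesic D) k.
Proof.
move=> sc; pose rk1 (u : D) : nat := enum_rank u.
(* The offset [#|D|] keeps arc colours apart from vertex colours. *)
pose rk2 (e : D * D) : nat := #|D| + enum_rank e.
exists (#|D| + #|{: D * D}|), rk1, (fun u v => rk2 (u, v)).
split=> [u|u v _|u v]; first exact/ltn_addr/ltn_ord.
  by rewrite ltn_add2l ltn_ord.
have [p gp] := geodesic_exists (sc u v); exists p => //.
case: gp => -[_ up _] _.
have inj1 : injective rk1 by move=> x y /val_inj/enum_rank_inj.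
have inj2 : injective rk2 by move=> e f /addnI/val_inj/enum_rank_inj.
have pairE : pairmap (fun u v => rk2 (u, v)) u p = map rk2 (pairmap pair u p).
  by elim: p u {up} => //= w p IHp u; rewrite IHp.
(* The heads of the successive arcs form [p], which has no repetition, so the arcs are distinct. *)
have sndE : map snd (pairmap pair u p) = p.
  by elim: p u {up pairE} => //= w p IHp u; rewrite IHp.
rewrite /total_rainbow pairE cat_uniq !map_inj_uniq //.
apply/and3P; split.
- have : uniq (belast u p) by move: up; rewrite lastI rcons_uniq => /andP[].
  by rewrite /internal; case: (belast u p) => //= ? ? /andP[].
- apply/hasPn => _ /mapP[e _ ->]; apply/mapP => -[w _ eqw].
  by have := ltn_ord (enum_rank w); rewrite -[nat_of_ord _]eqw ltnNge leq_addr.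
- by apply: (@map_uniq _ _ snd); rewrite sndE; case/andP: up.
Qed.

Lemma trc_le_strc : strongly_connected D -> trc D <= strc D.
Proof.
move=> sc; have tg := total_geodesic_connectable sc.
apply: least_ge => // j /total_geodesic_dipath tj.
have ex : exists k, total_connectable (@dipath D) k by exists j.
exact: (leastP ex).2.
Qed.

Lemma trc_ge s : strongly_connected D ->
  (forall j, total_connectable (@dipath D) j -> s <= j) -> s <= trc D.
Proof.
move=> /total_geodesic_connectable[k /total_geodesic_dipath tk].
by apply: least_ge; exists k.
Qed.

Lemma rainbow_size_leq k ca u p :
  @arc_colouring D k ca -> path (@Defs.arc D) u p -> rainbow ca u p -> size p <= k.
Proof.
move=> hca up; rewrite -(size_pairmap ca u p) => /uniq_ltn_size; apply.
elim: p u up => //= w p IHp u /andP[uw wp] x; rewrite in_cons.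
by case/predU1P=> [->|]; [apply: hca | apply: IHp].
Qed.

(** Since [d] to a fixed target drops by at most one along each arc and ends at 0, it bounds path
    lengths from below; no analysis of the paths themselves is needed. *)
Lemma potential_leq_size (d : D -> D -> nat) :
  (forall v, d v v = 0) -> (forall u w v, Defs.arc u w -> d u v <= (d w v).+1) ->
  forall u p, path (@Defs.arc D) u p -> d u (last u p) <= size p.
Proof.
move=> d0 dS u p; elim: p u => [|w p IHp] u /=; first by rewrite d0.
by case/andP=> uw /IHp; rewrite -ltnS; apply: leq_trans; apply: dS.
Qed.

End General.

(** * Complete digraph with pendant leaves, for part (a) *)

Section Corona.
Variable n : nat.

Definition corona_vertex : finType := ('I_n * bool)%type.

(* [(i, true)] is the i-th hub and [(i, false)] the leaf hanging on it. *)
Definition corona_arc : rel corona_vertex :=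
  fun u v => if u.1 == v.1 then u.2 != v.2 else u.2 && v.2.

Lemma corona_arc_irr : irreflexive corona_arc.
Proof. by move=> u; rewrite /corona_arc !eqxx. Qed.

Definition corona : digraph := Digraph corona_arc_irr.

(** Booleans count as numbers: between different hub indices there is one hub-to-hub arc, plus one
    arc for each end that is a leaf. *)
Definition corona_dist (u v : corona) : nat :=
  if u.1 == v.1 then (u.2 != v.2 : nat) else (~~ u.2 + ~~ v.2).+1.

Lemma corona_dist_leq (u v : corona) p :
  path (@Defs.arc corona) u p -> last u p = v -> corona_dist u v <= size p.
Proof.
move=> up <-; apply: potential_leq_size up => [[i b]|[i b] [l d] [j c]].
  by rewrite /corona_dist !eqxx.
rewrite /corona_dist /= /corona_arc /=.
have [<-|il] := eqVneq i l.
  by case: (i == j); case: b; case: c; case: d.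
have [ij|ij] := eqVneq i j; have [lj|lj] := eqVneq l j;
  by case: b; case: c; case: d.
Qed.

Definition corona_route (u v : corona) : seq corona :=
  if u.1 == v.1 then (if u.2 == v.2 then [::] else [:: v])
  else (if u.2 then [::] else [:: (u.1, true)])
       ++ (v.1, true) :: (if v.2 then [::] else [:: v]).

Lemma corona_route_geodesic u v : geodesic u v (corona_route u v).
Proof.
have sizeE : size (corona_route u v) = corona_dist u v.
  rewrite /corona_route /corona_dist; case: eqP => _; first by case: eqP.
  by case: u.2; case: v.2.
split; last by move=> q [uq _ eqv]; rewrite sizeE corona_dist_leq.
case: u v {sizeE} => i b [j c]; rewrite /corona_route /=.
have [<-|ij] := eqVneq i j.
  by case: b; case: c; split=> //=; rewrite ?/corona_arc /= ?eqxx //= inE;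
     rewrite xpair_eqE eqxx.
case: b; case: c; split=> //=;
  by rewrite /corona_arc /= ?eqxx ?(negPf ij) //= !inE !xpair_eqE ?eqxx
             ?(negPf ij) ?andbF.
Qed.

Lemma corona_strongly_connected : strongly_connected corona.
Proof.
move=> u v; exact: dipath_connect (geodesic_dipath (corona_route_geodesic u v)).
Qed.

Lemma corona_arc_connectable : arc_connectable (@geodesic corona) 3.
Proof.
(* Colours strictly increase along each route: 0 leaves a leaf, 1 joins two hubs, 2 enters a
   leaf. *)
pose ca (u v : corona) := if u.2 then (if v.2 then 1 else 2) else 0.
exists ca => [[i b] [j c] _|u v]; first by rewrite /ca; case: b; case: c.
exists (corona_route u v); first exact: corona_route_geodesic.
case: u v => i b [j c]; rewrite /corona_route /rainbow.
by case: eqP => _ /=; case: b; case: c.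
Qed.

(** Two leaves on different hubs are at distance 3, and a rainbow path needs one colour per arc. *)
Lemma corona_arc_colours k :
  1 < n -> arc_connectable (@dipath corona) k -> 2 < k.
Proof.
move=> n_gt1 [ca hca j]; pose x i : corona := (i, false).
pose i0 := Ordinal (ltnW n_gt1); pose i1 := Ordinal n_gt1.
have [p [xp _ lastp] rp] := j (x i0) (x i1).
exact: leq_trans (corona_dist_leq xp lastp) (rainbow_size_leq hca xp rp).
Qed.

Lemma corona_total_colours k : total_connectable (@dipath corona) k -> n <= k.
Proof.
case=> cv [ca [hcv _ joined]].
apply: (@inj_ltn_leq _ _ (fun i => cv (i, true))) => // i j eqc.
apply/eqP/negPn/negP => ij.
have [p [up uniqp lastp] rb] := joined (i, false) (j, false).
(* A leaf has its hub as only neighbour, so the path must start by entering hub [i]. *)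
case: p up lastp uniqp rb => [|[i' b] p] /=; first by move=> _ [/eqP]; rewrite (negPf ij).
rewrite /corona_arc /=; case: eqP => [<-{i'}|//] /andP[/= bT].
have {bT}-> : b = true by case: b bT.
(* Symmetrically, peeling off the final leaf shows that the vertex before it is hub [j]. *)
case/lastP: p => [//|p w]; rewrite last_rcons => + eqw; rewrite {}eqw {w}.
rewrite rcons_path => /andP[_]; rewrite /corona_arc /=.
case: eqP => [lastj lastT|]; last by rewrite andbF.
have lastE : last (i, true) p = (j, true).
  by case: (last _ p) lastj lastT => /= ? [] //= -> .
case/lastP: p lastE {lastj lastT} => [[/eqP]|p w]; first by rewrite (negPf ij).
rewrite last_rcons => -> _.
rewrite /total_rainbow /internal /= belast_rcons /= map_rcons eqc.
by rewrite mem_cat mem_rcons inE eqxx.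
Qed.

End Corona.

(** * Directed triangles sharing a vertex, for part (b) *)

Section Windmill.
Variable n : nat.

Definition windmill_vertex : finType := option ('I_n * bool).

(* [None] is the common vertex c, [Some (i, false)] is a_i and
   [Some (i, true)] is b_i. *)
Definition windmill_arc : rel windmill_vertex := fun u v =>
  match u, v with
  | None, Some (_, b) => ~~ b
  | Some (i, b), Some (j, c) => [&& i == j, ~~ b & c]
  | Some (_, b), None => b
  | None, None => false
  end.

Lemma windmill_arc_irr : irreflexive windmill_arc.
Proof. by case=> [[i []]|] //=; rewrite andbF. Qed.

Definition windmill : digraph := Digraph windmill_arc_irr.
Implicit Types (u v w : windmill) (p q : seq windmill).

Definition blade_in i : windmill := Some (i, false).
Definition blade_out i : windmill := Some (i, true).

(* A path leaving the common vertex by a blade that does not contain its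
   target would have to come back through the common vertex. *)
Definition windmill_step u v : windmill :=
  match u with
  | Some (i, b) => if b then None else blade_out i
  | None => if v is Some (j, _) then blade_in j else None
  end.

Lemma windmill_step_dipath u v w p :
  dipath u v (w :: p) -> w = windmill_step u v.
Proof.
case: u => [[i []]|] [] /=.
- by case: w => [[j c]|] //=; rewrite andbF.
- by case: w => [[j []]|] /=; rewrite ?andbF // => /andP[/andP[/eqP<-]].
(* Only at c is there a choice. After entering blade [i], the path stops at a_i or b_i, or returns
   to c, which would repeat a vertex. *)
case: w => [[i []]|] //=; case: p => [|[[j []]|] p] /=; rewrite ?andbF //.
- by move=> _ _ <-.
- case/andP=> /andP[/eqP<- _] {j}; case: p => [|[[j c]|] p] //=.
  + by move=> _ _ <-.
  + by rewrite andbF.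
Qed.

(** Each step is forced by the current vertex and the target, and a simple path from a vertex to
    itself is trivial. *)
Lemma windmill_dipath_uniq u v p q : dipath u v p -> dipath u v q -> p = q.
Proof.
have nil_dipath x r : @dipath windmill x x r -> r = [::].
  case: r => // w r [_ /= /andP[+ _] eqx].
  by rewrite -[X in X \notin _]eqx mem_last.
elim: p u q => [|w p IHp] u [|x q] //.
- by case=> _ _ /= <- /nil_dipath.
- by move=> + [_ _ /= eqv]; rewrite -eqv => /nil_dipath.
move=> dp dq; have := windmill_step_dipath dq.
rewrite -(windmill_step_dipath dp) => eqx; rewrite {}eqx in dq *.
congr (_ :: _); apply: (IHp w).
- by case: dp => /= /andP[_ ?] /andP[_ ?] ?.
- by case: dq => /= /andP[_ ?] /andP[_ ?] ?.
Qed.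

Lemma windmill_geodesic u v p : dipath u v p -> geodesic u v p.
Proof. by move=> dp; split=> // q /(windmill_dipath_uniq dp)<-. Qed.

(** Apart from trivial paths, only the arc from a_i to b_i avoids c; every other route is a path
    from [u] to c followed by one from c to [v]. *)
Definition windmill_route u v : seq windmill :=
  let in_blade := if (u, v) is (Some (i, false), Some (j, true)) then i == j
                  else false in
  if u == v then [::] else if in_blade then [:: v] else
  (match u with
   | Some (i, false) => [:: blade_out i; None]
   | Some (_, true) => [:: None]
   | None => [::]
   end) ++
  (match v with
   | Some (j, true) => [:: blade_in j; v]
   | Some (_, false) => [:: v]
   | None => [::]
   end).

Lemma windmill_route_dipath u v : dipath u v (windmill_route u v).
Proof.
rewrite /windmill_route; have [<-|] := eqVneq u v; first by [].
case: u v => [[i []]|] [[j []]|] //=; rewrite /blade_in /blade_out.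
all: rewrite ?(inj_eq (@Some_inj _)) ?xpair_eqE ?andbT ?andbF => ij.
all: try (case: eqP => [eij|/eqP nij]).
all: split=> //=; rewrite ?eij ?eqxx //= ?inE ?(inj_eq (@Some_inj _)) ?xpair_eqE.
all: rewrite ?andbF ?andbT ?orbF ?eqxx //=.
all: by rewrite ?(negPf ij) ?(negPf nij).
Qed.

Lemma windmill_strongly_connected : strongly_connected windmill.
Proof. by move=> u v; apply: dipath_connect (windmill_route_dipath u v). Qed.

Lemma windmill_trc_strc : trc windmill = strc windmill.
Proof.
congr least; apply/funext => k; apply/propext; split.
  case=> cv [ca [hcv hca j]]; exists cv, ca; split=> //.
  exact: all_joined_sub windmill_geodesic j.
exact: total_geodesic_dipath.
Qed.

Lemma windmill_vertex_connectable : vertex_connectable (@geodesic windmill) 3.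
Proof.
(* The internal vertices of a route form a segment of b_i, c, a_j, so each type occurs at most
   once. *)
pose cv u := if u is Some (_, b) then (if b then 0 else 2) else 1.
exists cv => [[[i []]|] //|u v]; exists (windmill_route u v).
  exact/windmill_geodesic/windmill_route_dipath.
rewrite /windmill_route /vertex_rainbow.
case: eqP => // _; case: u v => [[i []]|] [[j []]|] //=.
by case: eqP.
Qed.

Lemma windmill_long_dipath i j p : i != j ->
  dipath (blade_in i) (blade_out j) p ->
  p = [:: blade_out i; None; blade_in j; blade_out j].
Proof.
move=> ij dp; rewrite (windmill_dipath_uniq dp (windmill_route_dipath _ _)).
by rewrite /windmill_route /= (inj_eq (@Some_inj _)) xpair_eqE andbF (negPf ij).
Qed.

(** With two blades, the forced path from a_i to b_j has the three internal vertices b_i, c, a_j. *)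
Lemma windmill_vertex_colours k :
  1 < n -> vertex_connectable (@dipath windmill) k -> 2 < k.
Proof.
move=> n_gt1 [cv hcv joined].
pose i0 := Ordinal (ltnW n_gt1); pose i1 := Ordinal n_gt1.
have [p /windmill_long_dipath-> //] := joined (blade_in i0) (blade_out i1).
by move=> /uniq_ltn_size; apply=> _ /mapP[u _ ->].
Qed.

Lemma windmill_total_colours k :
  total_connectable (@dipath windmill) k -> n <= k.
Proof.
case=> cv [ca [_ hca joined]].
apply: (@inj_ltn_leq _ _ (fun i => ca (blade_in i) (blade_out i))); last first.
  by move=> i; apply: hca; rewrite /= eqxx.
move=> i j eqc; apply/eqP/negPn/negP => ij.
have [p /windmill_long_dipath-> //] := joined (blade_in i) (blade_out j).
by rewrite /total_rainbow cat_uniq => /and3P[_ _] /=; rewrite !inE eqc eqxx !orbT.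
Qed.

End Windmill.

Theorem theorem8 :
  (forall s : nat, 2 <= s ->
     exists D : digraph,
       [/\ strongly_connected D,
           s <= trc D, trc D <= strc D,
           rc D = 3 & src D = 3])
  /\
  (forall s : nat, 4 <= s ->
     exists D : digraph,
       [/\ strongly_connected D,
           trc D = strc D, s <= trc D,
           rvc D = 3 & srvc D = 3]).
Proof.
split=> s s_gt.
  have sc := @corona_strongly_connected s.
  have [ca hca joined] := corona_arc_connectable s.
  exists (corona s); split=> //.
  - exact: trc_ge sc (@corona_total_colours s).
  - exact: trc_le_strc.
  (* As geodesics are paths, the 3-colouring for geodesics also bounds [rc] from above, and the
     lower bound for paths also applies to [src]. *)
  - apply: least_eq => [|k]; last exact: corona_arc_colours.
    by exists ca => //; apply: all_joined_sub joined => u v p [].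
  - apply: least_eq => [|k [cb hcb jb]]; first by exists ca.
    apply: (@corona_arc_colours s) => //; exists cb => //.
    by apply: all_joined_sub jb => u v p [].
have s_gt1 : 1 < s by apply: leq_trans s_gt.
have sc := @windmill_strongly_connected s.
have [cv hcv joined] := windmill_vertex_connectable s.
exists (windmill s); split=> //.
- exact: windmill_trc_strc.
- exact: trc_ge sc (@windmill_total_colours s).
- apply: least_eq => [|k]; last exact: windmill_vertex_colours.
  by exists cv => //; apply: all_joined_sub joined => u v p [].
- apply: least_eq => [|k [cb hcb jb]]; first by exists cv.
  apply: (@windmill_vertex_colours s) => //; exists cb => //.
  by apply: all_joined_sub jb => u v p [].
Qed.
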